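(* Let $A\le B$ be real numbers with $A>1/e$. For every sequence $\mathbf a=(a_1,a_2,\dots)\in[A,B]^{\mathbb N}$, the Julia set of the non-autonomous system $(f^n_{\mathbf a})_{n\ge1}$ is the whole plane: $J_{\mathbf a}=\mathbb C$.
   Context: For $\eta\ne0$, $f_\eta:\mathbb C\to\mathbb C$ is $f_\eta(z)=\eta e^z$. For $\mathbf a=(a_1,a_2,\dots)\in[A,B]^{\mathbb N}$ put $f^n_{\mathbf a}:=f_{a_n}\circ f_{a_{n-1}}\circ\cdots\circ f_{a_2}\circ f_{a_1}$. The Fatou set $F_{\mathbf a}$ is the set of $z\in\mathbb C$ having a neighborhood $U$ on which the family $(f^n_{\mathbf a}|_U)_n$ is normal (in the usual sense of Montel: every sequence has a subsequence converging locally uniformly on $U$ in the spherical metric, locally uniform convergence to $\infty$ being allowed). The Julia set is $J_{\mathbf a}:=\mathbb C\setminus F_{\mathbf a}$. *)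

(* Defs.v *)
From Stdlib Require Import Reals.
From Coquelicot Require Import Coquelicot.

Open Scope R_scope.

(** * The Riemann sphere with its spherical metric *)

Inductive sphere : Type :=
| Fin (z : C)
| Infty.

(* Euclidean distance between the stereographic images on the unit sphere. *)
Definition chordal_dist (p q : sphere) : R :=
  match p, q with
  | Fin z, Fin w =>
      2 * Cmod (z - w)%C / (sqrt (1 + Cmod z ^ 2) * sqrt (1 + Cmod w ^ 2))
  | Fin z, Infty | Infty, Fin z => 2 / sqrt (1 + Cmod z ^ 2)
  | Infty, Infty => 0
  end.

(* Great-circle distance on the unit sphere: an arc of length s has a chord of
   length 2 sin (s / 2). *)
Definition spherical_dist (p q : sphere) : R :=
  2 * asin (chordal_dist p q / 2).

(** * Normal families *)

(* The limit [g] takes values in the sphere, so convergence to infinity is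
   included. *)
Definition cvg_loc_unif (U : C -> Prop) (f : nat -> C -> C) (g : C -> sphere) :
    Prop :=
  forall z : C, U z ->
  exists V : C -> Prop, locally z V /\
    forall eps : R, 0 < eps ->
    exists N : nat, forall n : nat, (N <= n)%nat ->
    forall w : C, U w -> V w -> spherical_dist (Fin (f n w)) (g w) < eps.

(* [s] is an arbitrary sequence of members of the family, with repetitions and
   in any order; [phi] extracts the subsequence. *)
Definition normal_family (I : Type) (U : C -> Prop) (F : I -> C -> C) : Prop :=
  forall s : nat -> I,
  exists (phi : nat -> nat) (g : C -> sphere),
    (forall m n : nat, (m < n)%nat -> (phi m < phi n)%nat) /\
    cvg_loc_unif U (fun n => F (s (phi n))) g.

(** * Non-autonomous iteration of exponential maps *)

Definition Cexp (z : C) : C := (exp (Re z) * cos (Im z), exp (Re z) * sin (Im z)).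

Definition exp_map (eta : C) (z : C) : C := (eta * Cexp z)%C.

(* Sequences are indexed from 0: [a n] is the (n+1)-st parameter, and
   [exp_iter a n] is the composition of the first [n] maps, the map with
   parameter [a 0] being applied first. *)
Fixpoint exp_iter (a : nat -> R) (n : nat) (z : C) : C :=
  match n with
  | O => z
  | S m => exp_map (RtoC (a m)) (exp_iter a m z)
  end.

(* The family consists of the [exp_iter a n] with [n >= 1]. *)
Definition Fatou_set (a : nat -> R) (z : C) : Prop :=
  exists U : C -> Prop,
    open U /\ U z /\ normal_family nat U (fun n => exp_iter a (S n)).

Definition Julia_set (a : nat -> R) (z : C) : Prop := ~ Fatou_set a z.

(* Main.v *)
Require Import Defs.
From Stdlib Require Import Reals Lra Lia Psatz Classical.
From Coquelicot Require Import Coquelicot.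

(* Write F_n for [exp_iter a n].

   If Im F_n(z) is never 0, then |Im F_n(z)| >= d for infinitely many n, where
   d > 0 depends only on A: near the real axis the real parts go to infinity
   (as A e > 1), and then the imaginary parts are expanded. Pulling a point w
   back along the orbit of z by branches of the logarithm that preserve the
   half-plane does not increase its hyperbolic distance to the orbit, and
   contracts it by a definite factor whenever |Im F_n(z)| >= d. Taking for w
   the point above or below F_n(z) with imaginary part in pi Z gives a point
   close to z that is mapped to the real axis: such points are dense.

   If F_N(z) is real then x_n = F_n(z) tends to infinity, while pulling back
   x_n + i pi by logarithms gives points w tending to z with
   F_(n+1)(w) = - x_(n+1), so that F_(n+2)(w) tends to 0. This excludes uniform
   convergence of a subsequence near z. *)

(** * The cardinal sine *)

Lemma sin_secant (u v : R) :
  u < v -> exists c, sin v - sin u = cos c * (v - u) /\ u < c < v.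
Proof.
intros Huv; apply (MVT_cor2 sin cos u v Huv).
intros c _; apply derivable_pt_lim_sin.
Qed.

Lemma sinc_decreasing (q p : R) :
  0 < q -> q < p -> p <= PI -> q * sin p < p * sin q.
Proof.
intros Hq Hqp Hp.
destruct (sin_secant 0 q Hq) as [c [Hc [Hc0 Hcq]]].
destruct (sin_secant q p Hqp) as [d [Hd [Hdq Hdp]]].
rewrite sin_0 in Hc.
assert (Hcos : cos d < cos c) by (apply cos_decreasing_1; lra).
replace (sin p) with (sin q + cos d * (p - q)) by lra.
replace (sin q) with (cos c * q) by lra.
assert (0 < q * (p - q)) by (apply Rmult_lt_0_compat; lra).
nra.
Qed.

Lemma sin_half_lower (x : R) : 0 <= x <= PI / 2 -> x / 2 <= sin x.
Proof.
intros [Hx0 Hx].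
assert (HPI := PI_4).
destruct (Req_dec x 0) as [->|Hn]; [rewrite sin_0; lra|].
destruct (Req_dec x (PI / 2)) as [->|Hn']; [rewrite sin_PI2; lra|].
assert (H : x * sin (PI / 2) < PI / 2 * sin x) by (apply sinc_decreasing; lra).
rewrite sin_PI2 in H.
assert (Hs : 0 < sin x) by (apply sin_gt_0; lra).
nra.
Qed.

Lemma sin_sqr_le (x : R) : sin x ^ 2 <= x ^ 2.
Proof.
rewrite <- !Rsqr_pow2; apply Rsqr_le_abs_1.
destruct (Rtotal_order x 0) as [H|[->|H]].
- rewrite (Rabs_left x H), <- Rabs_Ropp, <- sin_neg.
  assert (sin (- x) < - x) by (apply sin_lt_x; lra).
  apply Rabs_le; split; [|lra].
  destruct (Rle_dec (- x) PI).
  + assert (0 <= sin (- x)) by (apply sin_ge_0; lra); lra.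
  + destruct (SIN_bound (- x)); assert (HP := PI2_1); lra.
- rewrite sin_0; lra.
- rewrite (Rabs_right x) by lra.
  assert (sin x < x) by (apply sin_lt_x; lra).
  apply Rabs_le; split; [|lra].
  destruct (Rle_dec x PI).
  + assert (0 <= sin x) by (apply sin_ge_0; lra); lra.
  + destruct (SIN_bound x); assert (HP := PI2_1); lra.
Qed.

Lemma cos_lower (x : R) : 1 - x ^ 2 / 2 <= cos x.
Proof.
replace x with (2 * (x / 2)) at 2 by field.
rewrite cos_2a_sin.
assert (H := sin_sqr_le (x / 2)); nra.
Qed.

Lemma sinc_ratio (p0 t : R) :
  0 < p0 -> 0 < t < 1 ->
  exists nu, 0 < nu < 1 /\
    forall p q, p0 <= p -> 0 < q -> q <= t * p -> q < PI / 2 ->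
      q ^ 2 * sin p ^ 2 <= nu * p ^ 2 * sin q ^ 2.
Proof.
intros Hp0 [Ht0 Ht1].
assert (HPI := PI_RGT_0); assert (HPI4 := PI_4).
assert (Hfar : forall p q, PI <= p -> 0 < q -> q < PI / 2 ->
  q ^ 2 * sin p ^ 2 <= 1 / 4 * p ^ 2 * sin q ^ 2).
{ intros p q Hp Hq Hq2.
  assert (H : q * sin (PI / 2) < PI / 2 * sin q) by (apply sinc_decreasing; lra).
  rewrite sin_PI2 in H.
  assert (Hs := SIN_bound p).
  assert (Hq' : 0 < sin q) by (apply sin_gt_0; lra).
  assert (H1 : q <= p / 2 * sin q) by nra.
  assert (H2 : q ^ 2 <= (p / 2 * sin q) ^ 2) by (apply pow_incr; lra).
  assert (H3 : sin p ^ 2 <= 1) by nra.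
  assert (0 <= q ^ 2) by nra.
  nra. }
destruct (Rle_dec p0 PI) as [HpPI|HpPI]; cycle 1.
{ exists (1 / 4); split; [lra|]; intros; apply Hfar; lra. }
set (r := fun p => t * sin p / sin (t * p)).
assert (Hpos : forall p, p0 <= p <= PI -> 0 < sin (t * p)).
{ intros p Hp; apply sin_gt_0; nra. }
destruct (continuity_ab_maj r p0 PI HpPI) as [pm [Hmax Hpm]].
{ intros c Hc; unfold r.
  assert (Hs := Hpos c Hc).
  apply derivable_continuous_pt, ex_derive_Reals_0.
  auto_derive; lra. }
assert (Hr0 : forall p, p0 <= p <= PI -> 0 <= r p).
{ intros p Hp; unfold r.
  assert (Hs := Hpos p Hp).
  apply Rmult_le_pos; [|left; apply Rinv_0_lt_compat; lra].
  apply Rmult_le_pos; [lra|apply sin_ge_0; lra]. }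
assert (Hr1 : r pm < 1).
{ unfold r; assert (Hs := Hpos pm Hpm).
  apply Rlt_div_l; [lra|].
  assert (H : t * pm * sin pm < pm * sin (t * pm))
    by (apply sinc_decreasing; nra).
  apply Rmult_lt_reg_l with pm; nra. }
assert (Hrm := Hr0 pm Hpm).
assert (Hm1 := Rmax_l (1 / 4) (r pm ^ 2)).
assert (Hm2 := Rmax_r (1 / 4) (r pm ^ 2)).
exists (Rmax (1 / 4) (r pm ^ 2)); split.
{ split; [lra|apply Rmax_lub_lt; nra]. }
intros p q Hp Hq Hqt Hq2.
assert (Hps : 0 <= p ^ 2 * sin q ^ 2) by (apply Rmult_le_pos; apply pow2_ge_0).
destruct (Rle_dec p PI) as [Hpp|Hpp]; cycle 1.
{ assert (H := Hfar p q ltac:(lra) Hq Hq2); nra. }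
assert (Hsp : 0 <= sin p) by (apply sin_ge_0; lra).
assert (Hs := Hpos p ltac:(lra)).
assert (Hsq : 0 < sin q) by (apply sin_gt_0; lra).
assert (H1 : q * sin (t * p) <= t * p * sin q).
{ destruct (Req_dec q (t * p)) as [->|Hn]; [lra|].
  left; apply sinc_decreasing; nra. }
assert (H2 : t * sin p <= r pm * sin (t * p)).
{ apply Rle_div_l; [lra|]; apply (Hmax p); lra. }
assert (H3 : q * sin p <= r pm * p * sin q).
{ assert (H4 : (t * sin p) * (q * sin (t * p)) <=
               (r pm * sin (t * p)) * (t * p * sin q)).
  { apply Rmult_le_compat; [nra|nra|lra|lra]. }
  apply Rmult_le_reg_r with (t * sin (t * p)); nra. }
assert (H5 : (q * sin p) ^ 2 <= (r pm * p * sin q) ^ 2)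
  by (apply pow_incr; split; nra).
nra.
Qed.

(** * Hyperbolic distance under exponential maps *)

Lemma sin_Rabs_sqr (x : R) : sin (Rabs x) ^ 2 = sin x ^ 2.
Proof. unfold Rabs; destruct (Rcase_abs x); [rewrite sin_neg; ring|easy]. Qed.

Lemma sinc_contraction (p0 t : R) :
  0 < p0 -> t < 1 ->
  exists nu, 0 < nu < 1 /\
    forall p q, p0 <= Rabs p -> Rabs q <= t * Rabs p -> Rabs q < PI / 2 ->
      q ^ 2 * sin p ^ 2 <= nu * p ^ 2 * sin q ^ 2 /\
      sin p ^ 2 <= nu * p ^ 2.
Proof.
intros Hp0 Ht.
assert (HP := PI2_1).
set (t' := Rmax t (1 / 2)).
assert (Ht1 := Rmax_l t (1 / 2)); assert (Ht2 := Rmax_r t (1 / 2)).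
fold t' in Ht1, Ht2.
assert (Ht' : t' < 1) by (apply Rmax_lub_lt; lra).
destruct (sinc_ratio p0 t' Hp0 ltac:(lra)) as [nu [Hnu H]].
exists nu; split; [exact Hnu|].
intros p q Hp Hq Hq2.
rewrite <- (sin_Rabs_sqr p), <- (sin_Rabs_sqr q), <- (pow2_abs p), <- (pow2_abs q).
split.
- destruct (Req_dec (Rabs q) 0) as [->|Hn].
  + rewrite sin_0; lra.
  + assert (H0 := Rabs_pos q); apply H; try lra; nra.
- set (q0 := Rmin (p0 / 2) 1).
  assert (Hq0 : q0 <= p0 / 2) by apply Rmin_l.
  assert (Hq1 : q0 <= 1) by apply Rmin_r.
  assert (Hq00 : 0 < q0) by (apply Rmin_glb_lt; lra).
  assert (H1 : q0 ^ 2 * sin (Rabs p) ^ 2 <= nu * Rabs p ^ 2 * sin q0 ^ 2)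
    by (apply H; nra).
  assert (H2 := sin_sqr_le q0).
  assert (H3 : 0 <= nu * Rabs p ^ 2) by (apply Rmult_le_pos; [lra|apply pow2_ge_0]).
  apply Rmult_le_reg_l with (q0 ^ 2); [nra|].
  nra.
Qed.

Lemma sinc_sqr_le (p q : R) :
  Rabs q < Rabs p -> Rabs q < PI / 2 ->
  q ^ 2 * sin p ^ 2 <= p ^ 2 * sin q ^ 2.
Proof.
intros Hqp Hq.
assert (H0 := Rabs_pos q).
destruct (sinc_contraction (Rabs p) (Rabs q / Rabs p)) as [nu [Hnu H]].
- lra.
- apply Rlt_div_l; lra.
- destruct (H p q) as [H1 _]; [lra| |exact Hq|].
  + unfold Rdiv; rewrite Rmult_assoc, Rinv_l; lra.
  + assert (0 <= p ^ 2 * sin q ^ 2) by (apply Rmult_le_pos; apply pow2_ge_0).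
    nra.
Qed.

Lemma sinh_sqr_lower (h : R) : (2 * h) ^ 2 <= (exp h - exp (- h)) ^ 2.
Proof.
assert (Hpos : forall u, 0 < u -> 2 * u <= exp u - exp (- u)).
{ intros u Hu.
  destruct (MVT_cor2 sinh cosh 0 u Hu) as [c [Hc _]].
  { intros c _; apply derivable_pt_lim_sinh. }
  rewrite sinh_0 in Hc; unfold sinh, cosh in Hc.
  assert (Hm : exp c * exp (- c) = 1)
    by (rewrite <- exp_plus, Rplus_opp_r; apply exp_0).
  assert (H1 := exp_pos c); assert (H2 := exp_pos (- c)).
  assert (H3 : 2 <= exp c + exp (- c)).
  { assert (0 <= (exp c - exp (- c)) ^ 2) by apply pow2_ge_0; nra. }
  nra. }
destruct (Rtotal_order h 0) as [H|[->|H]].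
- assert (H1 := Hpos (- h) ltac:(lra)); rewrite Ropp_involutive in H1; nra.
- rewrite Ropp_0; lra.
- assert (H1 := Hpos h H); nra.
Qed.

Lemma exp_diff_sqr_lower (x x' : R) :
  exp x * exp x' * (x - x') ^ 2 <= (exp x - exp x') ^ 2.
Proof.
set (m := (x + x') / 2); set (h := (x - x') / 2).
replace x with (m + h) by (unfold m, h; field).
replace x' with (m + - h) by (unfold m, h; field).
rewrite !exp_plus.
assert (H := sinh_sqr_lower h).
assert (Hm : exp h * exp (- h) = 1)
  by (rewrite <- exp_plus, Rplus_opp_r; apply exp_0).
replace (exp m * exp h * (exp m * exp (- h))) with (exp m ^ 2)
  by (transitivity (exp m ^ 2 * (exp h * exp (- h))); [rewrite Hm|]; ring).
replace (exp m * exp h - exp m * exp (- h)) with (exp m * (exp h - exp (- h)))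
  by ring.
rewrite Rpow_mult_distr.
apply Rmult_le_compat_l; [apply pow2_ge_0|].
replace (m + h - (m + - h)) with (2 * h) by ring; exact H.
Qed.

(* On either half-plane this is [4 sinh (d / 2) ^ 2], with [d] the hyperbolic
   distance. *)
Definition hdist (z w : C) : R := Cmod (z - w) ^ 2 / (Im z * Im w).

Lemma Re_exp_map (c : R) (z : C) :
  Re (exp_map c z) = c * (exp (Re z) * cos (Im z)).
Proof. unfold exp_map, Cexp, RtoC, Cmult, Re, Im; simpl; ring. Qed.

Lemma Im_exp_map (c : R) (z : C) :
  Im (exp_map c z) = c * (exp (Re z) * sin (Im z)).
Proof. unfold exp_map, Cexp, RtoC, Cmult, Re, Im; simpl; ring. Qed.

Lemma Cmod_sub_sqr (z w : C) :
  Cmod (z - w) ^ 2 = (Re z - Re w) ^ 2 + (Im z - Im w) ^ 2.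
Proof.
rewrite Cmod2_alt; destruct z, w; unfold Re, Im; simpl; ring.
Qed.

(* With [p] and [q] the half sum and half difference of the imaginary parts,
   [Im z * Im w = p^2 - q^2], and the product of their sines is
   [sin p ^ 2 - sin q ^ 2]. *)
Lemma hdist_exp_map (c nu : R) (z w : C) :
  0 < c -> 0 < nu <= 1 ->
  0 < Im z * Im w -> 0 < sin (Im z) * sin (Im w) ->
  let p := (Im z + Im w) / 2 in
  let q := (Im z - Im w) / 2 in
  q ^ 2 * sin p ^ 2 <= nu * p ^ 2 * sin q ^ 2 ->
  sin p ^ 2 <= nu * p ^ 2 ->
  hdist z w <= nu * hdist (exp_map c z) (exp_map c w).
Proof.
intros Hc Hnu Hy Hs p q Hpq Hp.
unfold hdist; rewrite !Cmod_sub_sqr, !Re_exp_map, !Im_exp_map.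
destruct z as [x y], w as [x' y']; simpl Re in *; simpl Im in *.
assert (Ey : y = p + q) by (unfold p, q; field).
assert (Ey' : y' = p - q) by (unfold p, q; field).
clearbody p q; subst y y'.
assert (HX := exp_diff_sqr_lower x x').
set (E := exp x) in *; set (E' := exp x') in *.
assert (HE : 0 < E) by apply exp_pos; assert (HE' : 0 < E') by apply exp_pos.
set (s := sin (p + q) * sin (p - q)) in *.
assert (Hss : s = sin p ^ 2 - sin q ^ 2).
{ unfold s; rewrite sin_plus, sin_minus.
  assert (Hp2 := sin2_cos2 p); assert (Hq2 := sin2_cos2 q).
  rewrite !Rsqr_pow2 in Hp2, Hq2.
  replace (sin p ^ 2 - sin q ^ 2)
    with (sin p ^ 2 * (sin q ^ 2 + cos q ^ 2) - (sin p ^ 2 + cos p ^ 2) * sin q ^ 2)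
    by (rewrite Hp2, Hq2; ring).
  ring. }
set (Y := (p + q) * (p - q)) in *.
assert (HYY : Y = p ^ 2 - q ^ 2) by (unfold Y; ring).
assert (Hq0 := sin_sqr_le q).
assert (Hsq0 : 0 <= sin q ^ 2) by apply pow2_ge_0.
assert (H1 : q ^ 2 * s <= nu * Y * sin q ^ 2).
{ rewrite Hss, HYY.
  assert (nu * (q ^ 2 * sin q ^ 2) <= q ^ 2 * sin q ^ 2).
  { assert (0 <= q ^ 2 * sin q ^ 2) by (apply Rmult_le_pos; [apply pow2_ge_0|lra]).
    nra. }
  nra. }
assert (H2 : s <= nu * Y).
{ destruct (Req_dec q 0) as [->|Hq].
  - rewrite Hss, HYY, sin_0; lra.
  - apply Rmult_le_reg_l with (q ^ 2); [apply pow2_gt_0; exact Hq|].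
    apply Rle_trans with (1 := H1).
    rewrite Rmult_comm; apply Rmult_le_compat_r; [nra|exact Hq0]. }
set (cs := (c * (E * cos (p + q)) - c * (E' * cos (p - q))) ^ 2 +
  (c * (E * sin (p + q)) - c * (E' * sin (p - q))) ^ 2).
assert (Hcs : cs = c ^ 2 * ((E - E') ^ 2 + 4 * (E * E') * sin q ^ 2)).
{ assert (Hc1 := sin2_cos2 (p + q)); assert (Hc2 := sin2_cos2 (p - q)).
  rewrite !Rsqr_pow2 in Hc1, Hc2.
  assert (Hc3 : cos (p + q) * cos (p - q) + sin (p + q) * sin (p - q)
                = 1 - 2 * sin q ^ 2).
  { rewrite <- cos_minus.
    replace (p + q - (p - q)) with (2 * q) by ring; rewrite cos_2a_sin; ring. }
  unfold cs.
  transitivity (c ^ 2 * (E ^ 2 * (sin (p + q) ^ 2 + cos (p + q) ^ 2) +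
    E' ^ 2 * (sin (p - q) ^ 2 + cos (p - q) ^ 2) -
    2 * (E * E') * (cos (p + q) * cos (p - q) + sin (p + q) * sin (p - q)))).
  - ring.
  - rewrite Hc1, Hc2, Hc3; ring. }
rewrite Hcs.
replace (c * (E * sin (p + q)) * (c * (E' * sin (p - q))))
  with (c ^ 2 * (E * E') * s) by (unfold s; ring).
set (M := E * E') in *.
assert (HM : 0 < M) by (apply Rmult_lt_0_compat; assumption).
replace (nu * (c ^ 2 * ((E - E') ^ 2 + 4 * M * sin q ^ 2) / (c ^ 2 * M * s)))
  with (nu * ((E - E') ^ 2 / M + 4 * sin q ^ 2) / s) by (field; repeat split; lra).
set (X := (E - E') ^ 2 / M).
assert (HX' : (x - x') ^ 2 <= X).
{ apply -> Rle_div_r; [|exact HM]; rewrite Rmult_comm; exact HX. }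
apply Rle_div_l; [exact Hy|].
replace (p + q - (p - q)) with (2 * q) by ring.
replace (nu * (X + 4 * sin q ^ 2) / s * Y) with (nu * Y * (X + 4 * sin q ^ 2) / s)
  by (field; lra).
apply Rle_div_r; [exact Hs|].
assert (H0 : 0 <= (x - x') ^ 2) by apply pow2_ge_0.
assert (H3 : (x - x') ^ 2 * s <= X * (nu * Y)) by (apply Rmult_le_compat; lra).
nra.
Qed.

(** * Inverse branches *)

Lemma Cexp_plus (z w : C) : Cexp (z + w) = (Cexp z * Cexp w)%C.
Proof.
destruct z as [x y], w as [x' y']; unfold Cexp, Cplus, Cmult, Re, Im; simpl.
rewrite exp_plus, cos_plus, sin_plus; f_equal; ring.
Qed.

Lemma exp_map_plus (c : R) (z w : C) :
  exp_map c (z + w) = (exp_map c z * Cexp w)%C.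
Proof. unfold exp_map; rewrite Cexp_plus; ring. Qed.

(* The argument of [u] is twice that of [Cmod u + u]. *)
Definition Clog (u : C) : C :=
  (ln (Cmod u), 2 * atan (Im u / (Cmod u + Re u))).

Lemma Cexp_Clog (u : C) : 0 < Cmod u + Re u -> Cexp (Clog u) = u.
Proof.
intros H.
assert (Hm : Cmod u ^ 2 = Re u ^ 2 + Im u ^ 2) by apply Cmod2_alt.
assert (Hm0 : 0 < Cmod u).
{ destruct (Rle_lt_or_eq_dec 0 (Cmod u) (Cmod_ge_0 u)) as [H0|H0]; [exact H0|].
  rewrite <- H0 in Hm, H; nra. }
destruct u as [s t]; unfold Cexp, Clog, Re, Im in *; simpl fst in *; simpl snd in *.
set (m := Cmod (s, t)) in *.
rewrite exp_ln by exact Hm0.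
set (v := t / (m + s)).
assert (Hv : 1 + v² = 2 * m / (m + s)).
{ unfold v; rewrite Rsqr_div', !Rsqr_pow2.
  replace (t ^ 2) with (m ^ 2 - s ^ 2) by lra; field; lra. }
assert (Hv0 : 0 < 1 + v²) by (assert (H0 := Rle_0_sqr v); lra).
assert (Hsq : sqrt (1 + v²) * sqrt (1 + v²) = 1 + v²) by (apply sqrt_sqrt; lra).
assert (Hsq0 : 0 < sqrt (1 + v²)) by (apply sqrt_lt_R0; exact Hv0).
assert (Hc : cos (atan v) * cos (atan v) = (m + s) / (2 * m)).
{ rewrite cos_atan.
  replace (1 / sqrt (1 + v²) * (1 / sqrt (1 + v²)))
    with (/ (sqrt (1 + v²) * sqrt (1 + v²))) by (field; lra).
  rewrite Hsq, Hv; field; lra. }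
assert (Hs : sin (atan v) = v * cos (atan v)).
{ rewrite cos_atan, sin_atan; field; lra. }
rewrite cos_2a_cos, sin_2a, Hs; f_equal.
- replace (2 * cos (atan v) * cos (atan v))
    with (2 * (cos (atan v) * cos (atan v))) by ring.
  rewrite Hc; field; lra.
- replace (2 * (v * cos (atan v)) * cos (atan v))
    with (2 * v * (cos (atan v) * cos (atan v))) by ring.
  rewrite Hc; unfold v; field; lra.
Qed.

Lemma Im_Clog_lt (u : C) : Rabs (Im (Clog u)) < PI.
Proof.
unfold Clog; simpl.
assert (H := atan_bound (Im u / (Cmod u + Re u))).
apply Rabs_lt_between; unfold Im in *; lra.
Qed.

Lemma atan_Rabs_le (v : R) : Rabs (atan v) <= Rabs v.
Proof.
assert (H : forall u, 0 < u -> 0 <= atan u <= u).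
{ intros u Hu.
  destruct (MVT_cor2 atan (fun x => / (1 + x ^ 2)) 0 u Hu) as [c [Hc _]].
  { intros c _; apply is_derive_Reals; auto_derive; [easy|].
    rewrite <- Rsqr_pow2; unfold Rsqr; field; nra. }
  rewrite atan_0 in Hc.
  assert (H0 : 0 <= c ^ 2) by apply pow2_ge_0.
  assert (H1 : 0 < / (1 + c ^ 2)) by (apply Rinv_0_lt_compat; lra).
  assert (H2 : / (1 + c ^ 2) <= 1).
  { rewrite <- Rinv_1; apply Rinv_le_contravar; lra. }
  nra. }
destruct (Rtotal_order v 0) as [Hv|[->|Hv]].
- assert (H0 := H (- v) ltac:(lra)); rewrite atan_opp in H0.
  rewrite !Rabs_left1; lra.
- rewrite atan_0; lra.
- assert (H0 := H v Hv); rewrite !Rabs_right; lra.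
Qed.

Lemma ln_Rabs_le (m : R) : 1 / 2 <= m -> Rabs (ln m) <= 2 * Rabs (m - 1).
Proof.
intros Hm.
assert (H1 : ln m <= m - 1).
{ assert (H := exp_ineq1_le (ln m)); rewrite exp_ln in H; lra. }
assert (H2 : - ln m <= / m - 1).
{ assert (H := exp_ineq1_le (- ln m)).
  rewrite exp_Ropp, exp_ln in H; lra. }
assert (H3 : / m - 1 = (1 - m) / m) by (field; lra).
destruct (Rle_dec m 1) as [H|H].
- assert (H4 : (1 - m) / m <= 2 * (1 - m)) by (apply <- Rle_div_l; nra).
  rewrite (Rabs_left1 (m - 1)) by lra; apply Rabs_le; lra.
- assert (H4 : (1 - m) / m <= 0).
  { apply <- Rle_div_l; lra. }
  assert (H5 : 0 <= ln m) by (rewrite <- ln_1; apply ln_le; lra).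
  rewrite !Rabs_right; lra.
Qed.

Lemma Cmod_le_Rabs (z : C) : Cmod z <= Rabs (Re z) + Rabs (Im z).
Proof.
assert (H := Cmod2_alt z); assert (H0 := Cmod_ge_0 z).
rewrite <- (pow2_abs (Re z)), <- (pow2_abs (Im z)) in H.
assert (H1 := Rabs_pos (Re z)); assert (H2 := Rabs_pos (Im z)).
apply Rsqr_incr_0_var; [rewrite !Rsqr_pow2; nra|lra].
Qed.

Lemma Im_le_Cmod (z : C) : Rabs (Im z) <= Cmod z.
Proof.
assert (H := Cmod2_alt z); assert (H0 := Cmod_ge_0 z).
rewrite <- (Rabs_right (Cmod z)) by lra.
apply Rsqr_le_abs_0; rewrite !Rsqr_pow2; assert (H1 := pow2_ge_0 (Re z)); lra.
Qed.

Lemma Clog_near_1 (v : C) :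
  Cmod v <= 1 / 2 ->
  Cexp (Clog (1 + v)) = (1 + v)%C /\ Cmod (Clog (1 + v)) <= 4 * Cmod v.
Proof.
intros Hv.
assert (Hre := re_le_Cmod v); assert (Him := Im_le_Cmod v).
assert (Hre' := proj1 (Rabs_le_between _ _) (Rle_trans _ _ _ Hre Hv)).
assert (ER : Re (1 + v) = 1 + Re v) by (unfold Re; simpl; ring).
assert (EI : Im (1 + v) = Im v) by (unfold Im; simpl; ring).
assert (Hm := re_le_Cmod (1 + v)).
rewrite ER in Hm; rewrite Rabs_right in Hm by lra.
split; [apply Cexp_Clog; rewrite ER; lra|].
apply Rle_trans with (1 := Cmod_le_Rabs _).
assert (Hd : Rabs (Cmod (1 + v) - 1) <= Cmod v).
{ assert (H1 := Cmod_triangle 1 v); rewrite Cmod_1 in H1.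
  assert (H2 := Cmod_triangle (1 + v) (- v)); rewrite Cmod_opp in H2.
  replace (1 + v + - v)%C with (RtoC 1) in H2 by ring; rewrite Cmod_1 in H2.
  apply Rabs_le; lra. }
assert (Hl := ln_Rabs_le (Cmod (1 + v)) ltac:(lra)).
assert (Ha : Rabs (2 * atan (Im (1 + v) / (Cmod (1 + v) + Re (1 + v)))) <= 2 * Cmod v).
{ rewrite Rabs_mult, (Rabs_right 2) by lra.
  apply Rmult_le_compat_l; [lra|].
  apply Rle_trans with (1 := atan_Rabs_le _).
  rewrite EI, ER, Rabs_div, (Rabs_right (_ + _)) by lra.
  assert (Hden : 1 <= Cmod (1 + v) + (1 + Re v)) by lra.
  assert (H := Rabs_pos (Im v)).
  apply <- Rle_div_l; [|lra]; nra. }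
apply Rle_trans with (2 * Cmod v + 2 * Cmod v); [|lra].
apply Rplus_le_compat; [|exact Ha].
apply Rle_trans with (1 := Hl); lra.
Qed.

Lemma exp_map_preimage (c : R) (z w : C) :
  exp_map c z <> 0%C -> Cmod (w - exp_map c z) <= Cmod (exp_map c z) / 2 ->
  exists z', exp_map c z' = w /\
    Cmod (z' - z) <= 4 * Cmod (w - exp_map c z) / Cmod (exp_map c z).
Proof.
intros Hz Hw.
set (W := exp_map c z) in *.
assert (HW : 0 < Cmod W) by (apply Cmod_gt_0; exact Hz).
set (v := ((w - W) / W)%C).
assert (Hv : Cmod v = Cmod (w - W) / Cmod W) by (apply Cmod_div; exact Hz).
destruct (Clog_near_1 v) as [H1 H2].
{ rewrite Hv; apply <- Rle_div_l; lra. }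
exists (z + Clog (1 + v))%C; split.
- rewrite exp_map_plus, H1; fold W; unfold v; field; exact Hz.
- replace (z + Clog (1 + v) - z)%C with (Clog (1 + v)) by ring.
  apply Rle_trans with (1 := H2); rewrite Hv; apply Req_le; field; lra.
Qed.

Lemma exp_map_neq_0 (c : R) (z : C) : 0 < c -> exp_map c z <> 0%C.
Proof.
intros Hc H.
assert (Hr := Re_exp_map c z); assert (Hi := Im_exp_map c z).
rewrite H in Hr, Hi; unfold Re at 1 in Hr; unfold Im at 1 in Hi; simpl in Hr, Hi.
assert (He := exp_pos (Re z)).
assert (Hce : 0 < c * exp (Re z)) by (apply Rmult_lt_0_compat; lra).
assert (Hsc := sin2_cos2 (Im z)); unfold Rsqr in Hsc.
assert (cos (Im z) = 0) by nra.
assert (sin (Im z) = 0) by nra.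
nra.
Qed.

Lemma same_sign_strip (y y' : R) :
  Rabs (y' - y) < PI -> 0 < sin y * sin y' -> 0 < y * y'.
Proof.
assert (Hpos : forall u u', Rabs (u' - u) < PI -> 0 < sin u * sin u' ->
  0 < u -> 0 < u * u').
{ intros u u' Hd Hs Hu.
  apply Rabs_lt_between in Hd.
  destruct (Rlt_dec 0 u') as [H|H]; [nra|].
  assert (0 < sin u) by (apply sin_gt_0; lra).
  assert (0 <= sin (- u')) by (apply sin_ge_0; lra).
  rewrite sin_neg in *; nra. }
intros Hd Hs.
destruct (Rtotal_order y 0) as [H|[->|H]].
- replace (y * y') with (- y * - y') by ring.
  apply Hpos; [|rewrite !sin_neg; lra|lra].
  rewrite Rabs_minus_sym; replace (- y - - y') with (y' - y) by ring; exact Hd.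
- rewrite sin_0 in Hs; lra.
- apply Hpos; assumption.
Qed.

Lemma half_sum_diff_lt (y y' : R) :
  0 < y * y' -> Rabs ((y - y') / 2) < Rabs ((y + y') / 2).
Proof. intros H; apply Rsqr_lt_abs_0; rewrite !Rsqr_pow2; nra. Qed.

Lemma halfplane_preimage (c : R) (z w : C) :
  0 < c -> 0 < Im (exp_map c z) * Im w ->
  exists z', exp_map c z' = w /\ 0 < Im z * Im z' /\
    0 < sin (Im z) * sin (Im z') /\ Rabs ((Im z - Im z') / 2) < PI / 2.
Proof.
intros Hc Hw.
set (W := exp_map c z) in *.
assert (HW : W <> 0%C) by (apply exp_map_neq_0; exact Hc).
set (u := (w / W)%C).
assert (Hu : (w = u * W)%C) by (unfold u; field; exact HW).
assert (Hlog : 0 < Cmod u + Re u).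
{ assert (Hre := re_le_Cmod u).
  destruct (Rlt_dec 0 (Cmod u + Re u)) as [H|H]; [exact H|exfalso].
  assert (H1 : Cmod u = - Re u).
  { assert (H2 := Rabs_maj2 (Re u)); lra. }
  assert (H2 := Cmod2_alt u); rewrite H1 in H2.
  assert (H3 : Im u = 0) by nra.
  assert (H4 : Im w = Re u * Im W).
  { transitivity (Re u * Im W + Im u * Re W); [|rewrite H3; ring].
    rewrite Hu; unfold Re, Im; simpl; ring. }
  rewrite H4 in Hw.
  assert (H5 : 0 <= - Re u) by (rewrite <- H1; apply Cmod_ge_0).
  nra. }
exists (z + Clog u)%C.
assert (He : exp_map c (z + Clog u) = w).
{ rewrite exp_map_plus, Cexp_Clog by exact Hlog; fold W; rewrite Hu; ring. }
assert (Hd : Rabs (Im (z + Clog u) - Im z) < PI).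
{ replace (Im (z + Clog u) - Im z) with (Im (Clog u)) by (unfold Im; simpl; ring).
  apply Im_Clog_lt. }
assert (Hs : 0 < sin (Im z) * sin (Im (z + Clog u))).
{ rewrite <- He in Hw; unfold W in Hw; rewrite !Im_exp_map in Hw.
  set (k := c * exp (Re z) * (c * exp (Re (z + Clog u)))).
  assert (Hk : 0 < k).
  { unfold k; repeat apply Rmult_lt_0_compat; try apply exp_pos; lra. }
  apply Rmult_lt_reg_l with k; [exact Hk|].
  rewrite Rmult_0_r; unfold k; nra. }
repeat split.
- exact He.
- apply same_sign_strip; assumption.
- exact Hs.
- rewrite Rabs_div, (Rabs_right 2), Rabs_minus_sym by lra; lra.
Qed.

Lemma half_diff_of_hdist (z w : C) (K : R) :
  0 < K -> 0 < Im z * Im w -> hdist z w <= K ->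
  Rabs ((Im z - Im w) / 2) <= sqrt (K / (4 + K)) * Rabs ((Im z + Im w) / 2).
Proof.
intros HK H Hd.
apply Rle_div_l in Hd; [|exact H].
rewrite Cmod_sub_sqr in Hd.
assert (H0 := pow2_ge_0 (Re z - Re w)).
rewrite <- !sqrt_Rsqr_abs, <- sqrt_mult_alt.
2: { apply Rmult_le_pos; [lra|left; apply Rinv_0_lt_compat; lra]. }
apply sqrt_le_1_alt; rewrite !Rsqr_pow2.
replace (K / (4 + K) * ((Im z + Im w) / 2) ^ 2)
  with (K * ((Im z + Im w) / 2) ^ 2 / (4 + K)) by (field; lra).
apply -> Rle_div_r; [lra|nra].
Qed.

Lemma halfplane_contraction (d K : R) :
  0 < d -> 0 < K ->
  exists nu, 0 < nu < 1 /\
    forall (c : R) (z w : C), 0 < c -> 0 < Im (exp_map c z) * Im w ->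
      hdist (exp_map c z) w <= K ->
      exists z', exp_map c z' = w /\ 0 < Im z * Im z' /\
        hdist z z' <= hdist (exp_map c z) w /\
        (d <= Rabs (Im z) -> hdist z z' <= nu * hdist (exp_map c z) w).
Proof.
intros Hd HK.
assert (Ht : sqrt (K / (4 + K)) < 1).
{ rewrite <- sqrt_1; apply sqrt_lt_1_alt; split.
  - apply Rmult_le_pos; [lra|left; apply Rinv_0_lt_compat; lra].
  - apply Rlt_div_l; lra. }
destruct (sinc_contraction (d / 2) (sqrt (K / (4 + K))) ltac:(lra) Ht)
  as [nu [Hnu Hsinc]].
exists nu; split; [exact Hnu|].
intros c z w Hc Hw HwK.
destruct (halfplane_preimage c z w Hc Hw) as [z' [He [Hy [Hs Hq]]]].
subst w.
assert (H1 : hdist z z' <= hdist (exp_map c z) (exp_map c z')).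
{ rewrite <- (Rmult_1_l (hdist (exp_map c z) _)).
  apply hdist_exp_map; try assumption; [lra| |].
  - rewrite Rmult_1_l; apply sinc_sqr_le; [|exact Hq].
    apply half_sum_diff_lt; exact Hy.
  - rewrite Rmult_1_l; apply sin_sqr_le. }
exists z'; repeat split; try assumption.
intros Hz.
destruct (Hsinc ((Im z + Im z') / 2) ((Im z - Im z') / 2)) as [H2 H3].
- apply Rle_trans with (Rabs (Im z) / 2); [lra|].
  rewrite Rabs_div, (Rabs_right 2) by lra.
  apply Rmult_le_compat_r; [lra|].
  apply Rsqr_le_abs_0; rewrite !Rsqr_pow2; nra.
- apply half_diff_of_hdist; try assumption; lra.
- exact Hq.
- apply hdist_exp_map; try assumption; lra.
Qed.

(** * Iterates *)

Lemma exp_iter_S (a : nat -> R) (n : nat) (z : C) :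
  exp_iter a (S n) z = exp_map (a n) (exp_iter a n z).
Proof. reflexivity. Qed.

Fixpoint visits (d : R) (a : nat -> R) (z : C) (n : nat) : nat :=
  match n with
  | O => O
  | S m => if Rle_dec d (Rabs (Im (exp_iter a m z))) then S (visits d a z m)
           else visits d a z m
  end.

Lemma visits_le (d : R) (a : nat -> R) (z : C) (m n : nat) :
  (m <= n)%nat -> (visits d a z m <= visits d a z n)%nat.
Proof.
induction 1 as [|n _ IH]; [lia|simpl].
destruct (Rle_dec d (Rabs (Im (exp_iter a n z)))); lia.
Qed.

Lemma visits_unbounded (d : R) (a : nat -> R) (z : C) :
  (forall N, exists n, (N <= n)%nat /\ d <= Rabs (Im (exp_iter a n z))) ->
  forall m, exists n, (m <= visits d a z n)%nat.
Proof.
intros H; induction m as [|m [n IH]]; [exists O; lia|].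
destruct (H n) as [k [Hk Hd]]; exists (S k); simpl.
assert (H0 := visits_le d a z n k Hk).
destruct (Rle_dec d (Rabs (Im (exp_iter a k z)))); [lia|contradiction].
Qed.

Lemma exp_iter_contraction (d K : R) :
  0 < d -> 0 < K ->
  exists nu, 0 < nu < 1 /\
    forall (a : nat -> R) (z : C), (forall k, 0 < a k) ->
    forall n w, 0 < Im (exp_iter a n z) * Im w ->
      hdist (exp_iter a n z) w <= K ->
      exists z', exp_iter a n z' = w /\ 0 < Im z * Im z' /\
        hdist z z' <= nu ^ visits d a z n * hdist (exp_iter a n z) w.
Proof.
intros Hd HK.
destruct (halfplane_contraction d K Hd HK) as [nu [Hnu Hpull]].
exists nu; split; [exact Hnu|].
intros a z Ha; induction n as [|n IH]; intros w Hw HwK.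
- exists w; simpl; repeat split; [exact Hw|lra].
- destruct (Hpull (a n) (exp_iter a n z) w (Ha n) Hw HwK)
    as [w' [Hw' [Hs [Hle Hlt]]]].
  simpl in HwK.
  destruct (IH w' Hs ltac:(lra)) as [z' [Hz' [Hzs Hz]]].
  exists z'; split; [simpl; rewrite Hz'; exact Hw'|split; [exact Hzs|]].
  apply Rle_trans with (1 := Hz).
  assert (Hp : 0 < nu ^ visits d a z n) by (apply pow_lt; lra).
  simpl; destruct (Rle_dec d (Rabs (Im (exp_iter a n z)))) as [Hv|_].
  + simpl; rewrite (Rmult_comm nu), Rmult_assoc.
    apply Rmult_le_compat_l; [lra|exact (Hlt Hv)].
  + apply Rmult_le_compat_l; lra.
Qed.

Lemma exists_INR_gt (x : R) : exists n, x < INR n.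
Proof.
destruct (Rle_dec 0 x) as [H|H].
- destruct (nfloor_ex x H) as [n [_ Hn]]; exists (S n); rewrite S_INR; exact Hn.
- exists O; simpl; lra.
Qed.

Lemma geometric_unbounded (q x0 M : R) :
  1 < q -> 0 < x0 -> exists n, M < x0 * q ^ n.
Proof.
intros Hq Hx.
destruct (exists_INR_gt (M / (x0 * (q - 1)))) as [n Hn].
assert (Hk : 0 < x0 * (q - 1)) by (apply Rmult_lt_0_compat; lra).
apply -> Rlt_div_l in Hn; [|exact Hk].
exists n; assert (H := poly n (q - 1) ltac:(lra)).
replace (1 + (q - 1)) with q in H by ring; nra.
Qed.

(* Since [exp x >= e x], near the real axis the real part grows geometrically
   as soon as [a * e > 1]. *)
Lemma near_real_escape (A : R) :
  1 / exp 1 < A ->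
  exists d, 0 < d <= 1 /\
    forall (a : nat -> R) (z : C) (N : nat), (forall k, A <= a k) ->
      (forall n, (N <= n)%nat -> Rabs (Im (exp_iter a n z)) <= d) ->
      forall M, exists n0, (N <= n0)%nat /\
        forall n, (n0 <= n)%nat -> M <= Re (exp_iter a n z).
Proof.
intros HA.
assert (He := exp_pos 1).
assert (HAe : 1 < A * exp 1) by (apply -> Rlt_div_l in HA; lra).
assert (HA0 : 0 < A) by (apply Rmult_lt_reg_r with (exp 1); lra).
set (d := Rmin 1 (1 - / (A * exp 1))).
assert (Hd1 : d <= 1) by apply Rmin_l.
assert (Hd2 : d <= 1 - / (A * exp 1)) by apply Rmin_r.
assert (Hi : / (A * exp 1) < 1) 
  by (apply Rmult_lt_reg_l with (A * exp 1); [lra|rewrite Rinv_r; lra]).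
assert (Hi0 : 0 < / (A * exp 1)) by (apply Rinv_0_lt_compat; lra).
assert (Hd0 : 0 < d) by (apply Rmin_glb_lt; lra).
exists d; split; [lra|].
intros a z N Ha Hsmall M.
set (kap := A * (1 - d ^ 2 / 2)).
assert (Hq : 1 < kap * exp 1).
{ assert (H : / (A * exp 1) < 1 - d ^ 2 / 2) by nra.
  apply Rmult_lt_compat_l with (r := A * exp 1) in H; [|lra].
  rewrite Rinv_r in H by lra; unfold kap; lra. }
assert (Hkap : 0 < kap) by (unfold kap; apply Rmult_lt_0_compat; nra).
assert (Hstep : forall n, (N <= n)%nat ->
  kap * exp (Re (exp_iter a n z)) <= Re (exp_iter a (S n) z)).
{ intros n Hn; rewrite exp_iter_S, Re_exp_map.
  assert (H := Hsmall n Hn); assert (Hc := cos_lower (Im (exp_iter a n z))).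
  assert (Hx := exp_pos (Re (exp_iter a n z))).
  assert (H2 : Im (exp_iter a n z) ^ 2 <= d ^ 2).
  { rewrite <- (pow2_abs (Im _)); apply pow_incr; split; [apply Rabs_pos|exact H]. }
  assert (H3 := Ha n).
  assert (H4 : kap <= a n * cos (Im (exp_iter a n z))).
  { unfold kap; apply Rmult_le_compat; nra. }
  nra. }
assert (Hexp : forall x, exp 1 * x <= exp x).
{ intros x; replace (exp x) with (exp 1 * exp (x - 1))
    by (rewrite <- exp_plus; f_equal; ring).
  apply Rmult_le_compat_l; [lra|].
  assert (H := exp_ineq1_le (x - 1)); lra. }
set (x0 := Re (exp_iter a (S N) z)).
assert (Hx0 : 0 < x0).
{ apply Rlt_le_trans with (2 := Hstep N (Nat.le_refl N)).
  apply Rmult_lt_0_compat; [exact Hkap|apply exp_pos]. }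
assert (Hg : forall j, x0 * (kap * exp 1) ^ j <= Re (exp_iter a (j + S N) z)).
{ induction j as [|j IH]; [apply Req_le, Rmult_1_r|].
  apply Rle_trans with (2 := Hstep (j + S N)%nat ltac:(lia)).
  assert (H := Hexp (Re (exp_iter a (j + S N) z))).
  change ((kap * exp 1) ^ S j) with (kap * exp 1 * (kap * exp 1) ^ j).
  apply Rle_trans with (kap * (exp 1 * Re (exp_iter a (j + S N) z))).
  - replace (x0 * (kap * exp 1 * (kap * exp 1) ^ j))
      with (kap * (exp 1 * (x0 * (kap * exp 1) ^ j))) by ring.
    apply Rmult_le_compat_l; [lra|apply Rmult_le_compat_l; lra].
  - apply Rmult_le_compat_l; lra. }
destruct (geometric_unbounded (kap * exp 1) x0 M Hq Hx0) as [j0 Hj0].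
exists (j0 + S N)%nat; split; [lia|].
intros n Hn.
replace n with ((n - S N) + S N)%nat by lia.
apply Rle_trans with (2 := Hg (n - S N)%nat).
apply Rle_trans with (x0 * (kap * exp 1) ^ j0); [lra|].
apply Rmult_le_compat_l; [lra|apply Rle_pow; [lra|lia]].
Qed.

Lemma imaginary_part_dichotomy (A : R) :
  1 / exp 1 < A ->
  exists d, 0 < d /\
    forall (a : nat -> R) (z : C), (forall k, A <= a k) ->
      (exists n, Im (exp_iter a n z) = 0) \/
      forall N, exists n, (N <= n)%nat /\ d <= Rabs (Im (exp_iter a n z)).
Proof.
intros HA.
destruct (near_real_escape A HA) as [d [Hd Hesc]].
exists d; split; [lra|].
intros a z Ha.
destruct (classic (exists n, Im (exp_iter a n z) = 0)) as [H|H0]; [left; exact H|right].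
intros N; apply NNPP; intros HN.
assert (Hsmall : forall n, (N <= n)%nat -> Rabs (Im (exp_iter a n z)) < d).
{ intros n Hn; apply Rnot_le_lt; intros H; apply HN; exists n; split; assumption. }
destruct (Hesc a z N Ha (fun n Hn => Rlt_le _ _ (Hsmall n Hn)) 4) as [n0 [Hn0 Hre]].
assert (HA0 : 0 < A).
{ apply Rlt_trans with (2 := HA); apply Rdiv_lt_0_compat; [lra|apply exp_pos]. }
assert (HP := PI2_1).
assert (Hstep : forall n, (n0 <= n)%nat ->
  2 * Rabs (Im (exp_iter a n z)) <= Rabs (Im (exp_iter a (S n) z))).
{ intros n Hn.
  assert (Hr := Hre (S n) ltac:(lia)); assert (Hs := Hsmall n ltac:(lia)).
  rewrite exp_iter_S in Hr |- *; rewrite Re_exp_map in Hr; rewrite Im_exp_map.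
  set (y := Im (exp_iter a n z)) in *; set (E := exp (Re (exp_iter a n z))) in *.
  assert (HE : 0 < a n * E).
  { apply Rmult_lt_0_compat; [assert (H := Ha n); lra|apply exp_pos]. }
  assert (HE4 : 4 <= a n * E) by (destruct (COS_bound y); nra).
  rewrite <- Rmult_assoc, Rabs_mult, (Rabs_right (a n * E)) by lra.
  assert (Hsin : Rabs y / 2 <= Rabs (sin y)).
  { apply Rle_trans with (sin (Rabs y)).
    - apply sin_half_lower; split; [apply Rabs_pos|lra].
    - unfold Rabs at 1; destruct (Rcase_abs y); [rewrite sin_neg, <- Rabs_Ropp|];
        apply Rle_abs. }
  assert (H := Rabs_pos y); nra. }
assert (Hg : forall j,
  Rabs (Im (exp_iter a n0 z)) * 2 ^ j <= Rabs (Im (exp_iter a (j + n0) z))).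
{ induction j as [|j IH]; [simpl; lra|].
  apply Rle_trans with (2 := Hstep (j + n0)%nat ltac:(lia)).
  change (2 ^ S j) with (2 * 2 ^ j); lra. }
destruct (geometric_unbounded 2 (Rabs (Im (exp_iter a n0 z))) d) as [j Hj].
- lra.
- apply Rabs_pos_lt; intros H; apply H0; exists n0; exact H.
- assert (H1 := Hg j); assert (H2 := Hsmall (j + n0)%nat ltac:(lia)); lra.
Qed.

Lemma Cmod_lt_of_hdist (z : C) (eps : R) :
  0 < eps ->
  exists h, 0 < h /\ forall z', 0 < Im z * Im z' -> hdist z z' < h ->
    Cmod (z' - z) < eps.
Proof.
intros Heps.
set (y := Rabs (Im z)).
assert (Hy : 0 <= y) by apply Rabs_pos.
set (k := y * (y / eps + 1) + 1).
assert (Hye : 0 <= y / eps) by (apply -> Rle_div_r; lra).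
assert (Hk : 0 < k) by (unfold k; nra).
exists (eps / k); split; [apply Rdiv_lt_0_compat; lra|].
intros z' Hs Hh.
set (D := Cmod (z' - z)).
assert (HD : Cmod (z - z') = D).
{ unfold D; rewrite <- Cmod_opp; f_equal; ring. }
unfold hdist in Hh; rewrite HD in Hh.
apply -> Rlt_div_l in Hh; [|exact Hs].
assert (Hyy : Im z * Im z' <= y * (y + D)).
{ rewrite <- (Rabs_right (Im z * _)) by lra; rewrite Rabs_mult; fold y.
  apply Rmult_le_compat_l; [exact Hy|].
  assert (H := Im_le_Cmod (z' - z)); fold D in H.
  replace (Im z') with (Im z + Im (z' - z)) by (unfold Im; simpl; ring).
  apply Rle_trans with (1 := Rabs_triang _ _); fold y; lra. }
apply Rnot_le_lt; intros Hc.
assert (H1 : y <= y / eps * D).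
{ replace y with (y / eps * eps) at 1 by (field; lra).
  apply Rmult_le_compat_l; lra. }
assert (Hek : 0 < eps / k) by (apply Rdiv_lt_0_compat; lra).
assert (H2 : D ^ 2 < eps / k * (k * D)).
{ apply Rlt_le_trans with (1 := Hh); apply Rmult_le_compat_l; [lra|].
  apply Rle_trans with (1 := Hyy); unfold k; nra. }
replace (eps / k * (k * D)) with (eps * D) in H2 by (field; lra).
nra.
Qed.

Lemma sin_eq_0_near (y : R) :
  y <> 0 -> exists y', 0 < y * y' /\ Rabs (y - y') <= PI /\ PI <= Rabs y' /\ sin y' = 0.
Proof.
assert (HP := PI_RGT_0).
assert (Hpos : forall u, 0 < u -> exists v, u <= v <= u + PI /\ PI <= v /\ sin v = 0).
{ intros u Hu.
  destruct (nfloor_ex (u / PI)) as [n [Hn1 Hn2]].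
  { apply Rlt_le, Rdiv_lt_0_compat; lra. }
  apply <- Rle_div_r in Hn1; [|lra]; apply -> Rlt_div_l in Hn2; [|lra].
  assert (H0 := pos_INR n).
  exists ((INR n + 1) * PI); repeat split; try nra.
  apply sin_eq_0_1; exists (Z.of_nat (S n)); rewrite <- INR_IZR_INZ, S_INR; ring. }
intros Hy; destruct (Rtotal_order y 0) as [H|[H|H]]; [|contradiction|].
- destruct (Hpos (- y) ltac:(lra)) as [v [H1 [H2 H3]]].
  exists (- v); repeat split.
  + nra.
  + apply Rabs_le; lra.
  + rewrite Rabs_Ropp, Rabs_right; lra.
  + rewrite sin_neg; lra.
- destruct (Hpos y H) as [v [H1 [H2 H3]]].
  exists v; repeat split.
  + nra.
  + apply Rabs_le; lra.
  + rewrite Rabs_right; lra.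
  + exact H3.
Qed.

Lemma real_preimages_dense (A : R) (a : nat -> R) :
  1 / exp 1 < A -> (forall k, A <= a k) ->
  forall z eps, 0 < eps ->
    exists z' n, Cmod (z' - z) < eps /\ Im (exp_iter a n z') = 0.
Proof.
intros HA Ha z eps Heps.
assert (HA0 : 0 < A).
{ apply Rlt_trans with (2 := HA); apply Rdiv_lt_0_compat; [lra|apply exp_pos]. }
destruct (imaginary_part_dichotomy A HA) as [d [Hd Hdich]].
destruct (Hdich a z Ha) as [[n Hn]|Hinf].
{ exists z, n; split; [|exact Hn].
  replace (z - z)%C with (RtoC 0) by ring; rewrite Cmod_0; exact Heps. }
assert (HP := PI_RGT_0).
set (K := PI / d).
assert (HK : 0 < K) by (apply Rdiv_lt_0_compat; lra).
destruct (exp_iter_contraction d K Hd HK) as [nu [Hnu Hpull]].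
destruct (Cmod_lt_of_hdist z eps Heps) as [h [Hh Hclose]].
destruct (pow_lt_1_zero nu ltac:(rewrite Rabs_right; lra) (h / K)) as [m Hm].
{ apply Rdiv_lt_0_compat; lra. }
destruct (visits_unbounded d a z Hinf m) as [n1 Hn1].
destruct (Hinf n1) as [n [Hn Hdn]].
set (w := exp_iter a n z) in *.
assert (Hw0 : Im w <> 0) by (intros H; rewrite H, Rabs_R0 in Hdn; lra).
destruct (sin_eq_0_near (Im w) Hw0) as [y' [Hs [Hy1 [Hy2 Hsin]]]].
set (w' := (Re w, y') : C).
assert (HwK : hdist w w' <= K).
{ unfold hdist; rewrite Cmod_sub_sqr; simpl Re; simpl Im.
  apply <- Rle_div_l; [|exact Hs].
  rewrite <- (pow2_abs (Im w - y')), <- (Rabs_right (Im w * y')), Rabs_mult by lra.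
  unfold K; replace (Re w - Re w) with 0 by ring.
  apply Rle_trans with (PI * PI); [assert (H := Rabs_pos (Im w - y')); nra|].
  replace (PI * PI) with (PI / d * (d * PI)) by (field; lra).
  apply Rmult_le_compat_l; [exact (Rlt_le _ _ HK)|apply Rmult_le_compat; lra]. }
destruct (Hpull a z (fun k => Rlt_le_trans _ _ _ HA0 (Ha k)) n w' Hs HwK)
  as [z' [Hz' [Hzs Hz]]].
exists z', (S n); split.
- apply Hclose; [exact Hzs|].
  apply Rle_lt_trans with (1 := Hz).
  fold w.
  assert (H1 := Hm (visits d a z n)
    ltac:(assert (H2 := visits_le d a z n1 n Hn); lia)).
  assert (H3 : 0 < nu ^ visits d a z n) by (apply pow_lt; lra).
  rewrite Rabs_right in H1 by lra.
  apply <- Rlt_div_r in H1; [|lra].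
  nra.
- rewrite exp_iter_S, Hz', Im_exp_map; unfold w', Im at 1; simpl snd; rewrite Hsin; ring.
Qed.

Lemma exp_iter_preimage_near (a : nat -> R) :
  (forall k, 0 < a k) ->
  forall n z eps, 0 < eps ->
    exists eta, 0 < eta /\ forall w, Cmod (w - exp_iter a n z) < eta ->
      exists z', Cmod (z' - z) < eps /\ exp_iter a n z' = w.
Proof.
intros Ha; induction n as [|n IH]; intros z eps Heps.
{ exists eps; split; [exact Heps|]; intros w Hw; exists w; split; [exact Hw|easy]. }
destruct (IH z eps Heps) as [eta [Heta H]].
set (w0 := exp_iter a (S n) z).
assert (Hw0 : w0 <> 0%C) by (apply exp_map_neq_0, Ha).
assert (Hm : 0 < Cmod w0) by (apply Cmod_gt_0; exact Hw0).
exists (Rmin (Cmod w0 / 2) (eta * Cmod w0 / 4)); split.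
{ apply Rmin_glb_lt; [lra|nra]. }
intros w Hw.
assert (H1 := Rlt_le_trans _ _ _ Hw (Rmin_l _ _)).
assert (H2 := Rlt_le_trans _ _ _ Hw (Rmin_r _ _)).
destruct (exp_map_preimage (a n) (exp_iter a n z) w Hw0 (Rlt_le _ _ H1))
  as [w' [Hw' Hd]].
destruct (H w') as [z' [Hz' Hz]].
{ apply Rle_lt_trans with (1 := Hd).
  change (4 * Cmod (w - w0) / Cmod w0 < eta).
  apply <- Rlt_div_l; [|exact Hm].
  change (w - exp_iter a (S n) z)%C with (w - w0)%C in H2; lra. }
exists z'; split; [exact Hz'|simpl; rewrite Hz; exact Hw'].
Qed.

Lemma exp_iter_cover (a : nat -> R) (z : C) (n0 : nat) (eps : R) :
  (forall k, 0 < a k) -> 0 < eps ->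
  (forall n, (n0 <= n)%nat -> 8 <= Re (exp_iter a n z)) ->
  exists n1, forall n, (n1 <= n)%nat ->
    forall w, Cmod (w - exp_iter a n z) <= 4 ->
    exists z', Cmod (z' - z) < eps /\ exp_iter a n z' = w.
Proof.
intros Ha Heps Hre.
destruct (exp_iter_preimage_near a Ha n0 z eps Heps) as [eta [Heta Hloc]].
assert (H : forall j w, Cmod (w - exp_iter a (j + n0) z) <= 4 ->
  Cmod (w - exp_iter a (j + n0) z) < eta * 2 ^ j ->
  exists z', Cmod (z' - z) < eps /\ exp_iter a (j + n0) z' = w).
{ induction j as [|j IH]; intros w H4 Hw.
  { apply Hloc; simpl in Hw; lra. }
  set (w0 := exp_iter a (S j + n0) z) in *.
  assert (Hm : 8 <= Cmod w0).
  { apply Rle_trans with (1 := Hre (S j + n0)%nat ltac:(lia)).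
    apply Rle_trans with (2 := re_le_Cmod w0); apply Rle_abs. }
  destruct (exp_map_preimage (a (j + n0)%nat) (exp_iter a (j + n0) z) w)
    as [w' [Hw' Hd]].
  { apply exp_map_neq_0, Ha. }
  { change (Cmod (w - w0) <= Cmod w0 / 2); lra. }
  change (Cmod (w' - exp_iter a (j + n0) z) <= 4 * Cmod (w - w0) / Cmod w0) in Hd.
  assert (Hd' : Cmod (w' - exp_iter a (j + n0) z) <= Cmod (w - w0) / 2).
  { apply Rle_trans with (1 := Hd); apply <- Rle_div_l; [|lra].
    assert (H0 := Cmod_ge_0 (w - w0)); nra. }
  change (2 ^ S j) with (2 * 2 ^ j) in Hw.
  destruct (IH w') as [z' [Hz' Hz]].
  - lra.
  - lra.
  - exists z'; split; [exact Hz'|].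
    change (exp_map (a (j + n0)%nat) (exp_iter a (j + n0) z') = w).
    rewrite Hz; exact Hw'. }
destruct (geometric_unbounded 2 eta 4) as [j0 Hj0]; [lra|exact Heta|].
exists (j0 + n0)%nat; intros n Hn w Hw.
replace n with ((n - n0) + n0)%nat in * by lia.
apply H; [exact Hw|].
apply Rle_lt_trans with (1 := Hw); apply Rlt_le_trans with (1 := Hj0).
apply Rmult_le_compat_l; [lra|apply Rle_pow; [lra|lia]].
Qed.

(** * Normality on the sphere *)

Definition sphere_height (p : sphere) : R :=
  match p with
  | Fin z => / sqrt (1 + Cmod z ^ 2)
  | Infty => 0
  end.

Lemma sqrt_1_sqr_lipschitz (x y : R) :
  Rabs (sqrt (1 + x ^ 2) - sqrt (1 + y ^ 2)) <= Rabs (x - y).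
Proof.
assert (Hx := pow2_ge_0 x); assert (Hy := pow2_ge_0 y).
set (s := sqrt (1 + x ^ 2)); set (t := sqrt (1 + y ^ 2)).
assert (Hs : s * s = 1 + x ^ 2) by (apply sqrt_sqrt; lra).
assert (Ht : t * t = 1 + y ^ 2) by (apply sqrt_sqrt; lra).
assert (Hs0 : 0 <= s) by apply sqrt_pos.
assert (Ht0 : 0 <= t) by apply sqrt_pos.
apply Rsqr_le_abs_0; rewrite !Rsqr_pow2.
assert (H : 1 + x * y <= s * t).
{ apply Rle_trans with (Rabs (1 + x * y)); [apply Rle_abs|].
  rewrite <- (Rabs_right (s * t)) by nra.
  apply Rsqr_le_abs_0; rewrite !Rsqr_pow2.
  replace ((s * t) ^ 2) with ((1 + x ^ 2) * (1 + y ^ 2))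
    by (rewrite <- Hs, <- Ht; ring).
  assert (H := pow2_ge_0 (x - y)); nra. }
nra.
Qed.

Lemma sphere_height_chordal (z : C) (q : sphere) :
  Rabs (sphere_height (Fin z) - sphere_height q) <= chordal_dist (Fin z) q / 2.
Proof.
assert (Hpos : forall x, 0 < sqrt (1 + x ^ 2)).
{ intros x; apply sqrt_lt_R0; assert (H := pow2_ge_0 x); lra. }
assert (Hz := Hpos (Cmod z)).
destruct q as [w|]; unfold sphere_height, chordal_dist.
- assert (Hw := Hpos (Cmod w)).
  assert (H := sqrt_1_sqr_lipschitz (Cmod w) (Cmod z)).
  set (s := sqrt (1 + Cmod z ^ 2)) in *; set (t := sqrt (1 + Cmod w ^ 2)) in *.
  assert (Hst : 0 < s * t) by nra.
  replace (/ s - / t) with ((t - s) / (s * t)) by (field; lra).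
  replace (2 * Cmod (z - w) / (s * t) / 2) with (Cmod (z - w) / (s * t))
    by (field; lra).
  rewrite Rabs_div, (Rabs_right (s * t)) by lra.
  apply Rmult_le_compat_r; [left; apply Rinv_0_lt_compat; exact Hst|].
  apply Rle_trans with (1 := H).
  assert (H1 := Cmod_triangle (z - w) w); assert (H2 := Cmod_triangle (w - z) z).
  replace (z - w + w)%C with z in H1 by ring.
  replace (w - z + z)%C with w in H2 by ring.
  replace (w - z)%C with (- (z - w))%C in H2 by ring; rewrite Cmod_opp in H2.
  apply Rabs_le; lra.
- rewrite Rminus_0_r, Rabs_right; [right; field; lra|].
  left; apply Rinv_0_lt_compat; exact Hz.
Qed.

Lemma sphere_height_spherical (z : C) (q : sphere) (eps : R) :
  eps <= 1 -> spherical_dist (Fin z) q < eps ->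
  Rabs (sphere_height (Fin z) - sphere_height q) < eps / 2.
Proof.
intros Heps Hd.
apply Rle_lt_trans with (1 := sphere_height_chordal z q).
assert (Hc := Rle_trans _ _ _ (Rabs_pos _) (sphere_height_chordal z q)).
unfold spherical_dist in Hd.
set (y := chordal_dist (Fin z) q / 2) in *.
assert (HP := PI2_1).
destruct (Rlt_dec y 1) as [Hy|Hy].
- assert (Hs : sin (asin y) = y) by (apply sin_asin; lra).
  assert (Hb := asin_bound y).
  destruct (Rlt_dec 0 (asin y)) as [Ha|Ha].
  + assert (H := sin_lt_x _ Ha); lra.
  + assert (0 <= sin (- asin y)) by (apply sin_ge_0; lra).
    rewrite sin_neg in *.
    assert (Hy0 : y = 0) by lra.
    rewrite Hy0, asin_0 in Hd; lra.
- exfalso; unfold asin in Hd.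
  destruct (Rle_dec y (-1)); [lra|].
  destruct (Rle_dec 1 y); lra.
Qed.

Lemma continuous_Rmult_comp (f g : C -> R) (z : C) :
  continuous f z -> continuous g z -> continuous (fun w => f w * g w) z.
Proof. exact (continuous_mult (K := R_AbsRing) f g z). Qed.

Lemma continuous_Re_Im_exp_iter (a : nat -> R) (n : nat) (z : C) :
  continuous (fun w : C => Re (exp_iter a n w)) z /\
  continuous (fun w : C => Im (exp_iter a n w)) z.
Proof.
induction n as [|n [IHr IHi]].
{ destruct z; split; [apply continuous_fst|apply continuous_snd]. }
assert (He := continuous_comp _ exp _ IHr (continuous_exp _)).
split.
- apply continuous_ext with (fun w : C =>
    a n * (exp (Re (exp_iter a n w)) * cos (Im (exp_iter a n w)))).
  { intros w; rewrite exp_iter_S, Re_exp_map; reflexivity. }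
  apply continuous_Rmult_comp; [apply continuous_const|].
  apply continuous_Rmult_comp; [exact He|].
  exact (continuous_comp _ cos _ IHi (continuous_cos _)).
- apply continuous_ext with (fun w : C =>
    a n * (exp (Re (exp_iter a n w)) * sin (Im (exp_iter a n w)))).
  { intros w; rewrite exp_iter_S, Im_exp_map; reflexivity. }
  apply continuous_Rmult_comp; [apply continuous_const|].
  apply continuous_Rmult_comp; [exact He|].
  exact (continuous_comp _ sin _ IHi (continuous_sin _)).
Qed.

Lemma continuous_height_exp_iter (a : nat -> R) (n : nat) (z : C) :
  continuous (fun w : C => sphere_height (Fin (exp_iter a n w))) z.
Proof.
destruct (continuous_Re_Im_exp_iter a n z) as [Hr Hi].
apply continuous_ext with (fun w : C =>
  / sqrt (1 + (Re (exp_iter a n w) * Re (exp_iter a n w) +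
               Im (exp_iter a n w) * Im (exp_iter a n w)))).
{ intros w; unfold sphere_height; rewrite Cmod2_alt; do 3 f_equal; ring. }
apply (continuous_comp
  (fun w : C => Re (exp_iter a n w) * Re (exp_iter a n w) +
                Im (exp_iter a n w) * Im (exp_iter a n w))
  (fun x => / sqrt (1 + x))).
- apply (continuous_plus (K := R_AbsRing) (V := R_NormedModule)
    (fun w : C => Re (exp_iter a n w) * Re (exp_iter a n w))
    (fun w : C => Im (exp_iter a n w) * Im (exp_iter a n w)));
  apply continuous_Rmult_comp; assumption.
- apply (ex_derive_continuous (K := R_AbsRing) (V := R_NormedModule)
    (fun x : R => / sqrt (1 + x))).
  set (x := _ + _).
  assert (Hx : 0 <= x) by (unfold x; nra).
  assert (0 < sqrt (1 + x)) by (apply sqrt_lt_R0; lra).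
  auto_derive; lra.
Qed.

Lemma locally_C_Cmod (P : C -> Prop) (z : C) :
  locally z P -> exists eps, 0 < eps /\ forall w, Cmod (w - z) < eps -> P w.
Proof.
intros [eps H]; exists eps; split; [apply cond_pos|].
intros w Hw; apply H, C_NormedModule_mixin_compat1; exact Hw.
Qed.

Lemma sphere_height_le (z : C) (x : R) :
  0 < x <= Cmod z -> sphere_height (Fin z) <= / x.
Proof.
intros Hx; unfold sphere_height.
apply Rinv_le_contravar; [lra|].
rewrite <- (sqrt_pow2 x) at 1 by lra.
apply sqrt_le_1_alt; nra.
Qed.

Lemma sphere_height_lower (z : C) :
  Cmod z <= 1 -> / 2 <= sphere_height (Fin z).
Proof.
intros Hz; unfold sphere_height; assert (H := Cmod_ge_0 z).
assert (H1 : 0 < sqrt (1 + Cmod z ^ 2)) by (apply sqrt_lt_R0; nra).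
apply Rinv_le_contravar; [exact H1|].
rewrite <- (sqrt_pow2 2) by lra.
apply sqrt_le_1_alt; nra.
Qed.

Lemma cvg_loc_unif_height (U : C -> Prop) (F : nat -> C -> C) (g : C -> sphere)
    (z : C) (eps : R) :
  0 < eps -> open U -> U z -> cvg_loc_unif U F g ->
  (forall n, continuous (fun w => sphere_height (Fin (F n w))) z) ->
  exists N, forall m, (N <= m)%nat ->
    exists rho, 0 < rho /\ forall w n, Cmod (w - z) < rho -> (N <= n)%nat ->
      Rabs (sphere_height (Fin (F n w)) - sphere_height (Fin (F m z))) < eps.
Proof.
intros Heps HU Uz HF Hcont.
destruct (HF z Uz) as [V [HV Hunif]].
set (eta := Rmin 1 (eps / 4)).
assert (Heta : 0 < eta) by (apply Rmin_glb_lt; lra).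
assert (Heta1 : eta <= 1) by apply Rmin_l.
assert (Heta2 : eta <= eps / 4) by apply Rmin_r.
destruct (Hunif eta Heta) as [N HN].
exists N; intros m Hm.
assert (Hloc : locally z (fun w => U w /\ V w /\
  Rabs (sphere_height (Fin (F m w)) - sphere_height (Fin (F m z))) < eta)).
{ apply filter_and; [exact (HU z Uz)|].
  apply filter_and; [exact HV|].
  exact (proj1 (filterlim_locally _ _) (Hcont m) (mkposreal eta Heta)). }
destruct (locally_C_Cmod _ _ Hloc) as [rho [Hrho H]].
exists rho; split; [exact Hrho|].
intros w n Hw Hn.
destruct (H w Hw) as [HUw [HVw Hmw]].
assert (H1 := sphere_height_spherical _ _ _ Heta1 (HN n Hn w HUw HVw)).
assert (H2 := sphere_height_spherical _ _ _ Heta1 (HN m Hm w HUw HVw)).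
apply Rabs_lt_between in H1, H2, Hmw.
apply Rabs_lt_between; lra.
Qed.

Lemma exp_le_compat (x y : R) : x <= y -> exp x <= exp y.
Proof. intros [H| ->]; [left; apply exp_increasing; exact H|lra]. Qed.

Lemma exp_iter_small_near (a : nat -> R) (B : R) (z : C) (n : nat) :
  (forall k, 0 < a k <= B) -> Im (exp_iter a n z) = 0 ->
  B <= Re (exp_iter a (S n) z) ->
  exists w, Cmod (w - exp_iter a n z) <= 4 /\
    forall z', exp_iter a n z' = w -> Cmod (exp_iter a (S (S n)) z') <= 1.
Proof.
intros Ha Him HB.
assert (HP := PI_4); assert (HP0 := PI_RGT_0).
exists (Re (exp_iter a n z), PI); split.
- apply Rle_trans with (1 := Cmod_le_Rabs _).
  replace (Re (_ - _)) with 0 by (unfold Re; simpl; ring).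
  replace (Im (_ - _)) with PI.
  + rewrite Rabs_R0, Rabs_right; lra.
  + transitivity (PI - Im (exp_iter a n z)); [rewrite Him; ring|].
    unfold Im; simpl; ring.
- intros z' Hz'.
  rewrite exp_iter_S, Re_exp_map, Him, cos_0 in HB.
  assert (H1 : Re (exp_iter a (S n) z') <= - B).
  { rewrite exp_iter_S, Re_exp_map, Hz'; unfold Re at 1, Im at 1; simpl fst; simpl snd.
    rewrite cos_PI; lra. }
  assert (H2 : Im (exp_iter a (S n) z') = 0).
  { rewrite exp_iter_S, Im_exp_map, Hz'; unfold Im at 1; simpl snd.
    rewrite sin_PI; ring. }
  apply Rle_trans with (1 := Cmod_le_Rabs _).
  rewrite exp_iter_S, Re_exp_map, Im_exp_map, H2, cos_0, sin_0.
  destruct (Ha (S n)) as [Ha0 HaB].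
  assert (HE := exp_pos (Re (exp_iter a (S n) z'))).
  rewrite !Rmult_0_r, Rabs_R0, Rmult_1_r, Rplus_0_r, Rabs_right by nra.
  apply Rle_trans with (B * exp (- B)).
  + apply Rmult_le_compat; [lra|lra|exact HaB|apply exp_le_compat; exact H1].
  + rewrite exp_Ropp.
    assert (H3 := exp_ineq1_le B); assert (H4 := exp_pos B).
    apply <- Rle_div_l; lra.
Qed.

Theorem theorem7 (A B : R) (hAB : A <= B) (hA : 1 / exp 1 < A)
    (a : nat -> R) (ha : forall n : nat, A <= a n <= B) :
  forall z : C, Julia_set a z.
Proof.
intros z [U [HU [Uz Hnormal]]].
assert (HaA : forall k, A <= a k) by (intros k; apply ha).
assert (HA0 : 0 < A).
{ apply Rlt_trans with (2 := hA); apply Rdiv_lt_0_compat; [lra|apply exp_pos]. }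
assert (Ha0 : forall k, 0 < a k) by (intros k; assert (H := HaA k); lra).
destruct (locally_C_Cmod _ _ (HU z Uz)) as [r [Hr HrU]].
destruct (real_preimages_dense A a hA HaA z r Hr) as [z1 [N [Hz1 HN]]].
apply HrU in Hz1.
assert (Him : forall n, (N <= n)%nat -> Im (exp_iter a n z1) = 0).
{ induction 1 as [|n _ IH]; [exact HN|].
  rewrite exp_iter_S, Im_exp_map, IH, sin_0; ring. }
destruct (near_real_escape A hA) as [d [Hd Hesc]].
destruct (Hesc a z1 N HaA) with (M := Rmax 16 B) as [n0 [Hn0 Hre]].
{ intros n Hn; rewrite Him, Rabs_R0 by exact Hn; lra. }
assert (H16 := Rmax_l 16 B); assert (HB := Rmax_r 16 B).
destruct (Hnormal (fun n => n)) as [phi [g [Hphi Hcvg]]].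
assert (Hphin : forall n, (n <= phi n)%nat).
{ induction n as [|n IH]; [lia|]; assert (H := Hphi n (S n) ltac:(lia)); lia. }
destruct (cvg_loc_unif_height U _ g z1 (/ 4) ltac:(lra) HU Hz1 Hcvg)
  as [N1 Hequi].
{ intros n; apply continuous_height_exp_iter. }
set (m := Nat.max N1 n0).
destruct (Hequi m ltac:(lia)) as [rho [Hrho Hclose]].
assert (Hm : sphere_height (Fin (exp_iter a (S (phi m)) z1)) <= / 16).
{ apply sphere_height_le; split; [lra|].
  assert (H := Hphin m).
  apply Rle_trans with (2 := re_le_Cmod _), Rle_trans with (2 := Rle_abs _).
  apply Rle_trans with (1 := H16), Hre; lia. }
destruct (exp_iter_cover a z1 n0 rho Ha0 Hrho) as [n1 Hcover].
{ intros n Hn; assert (H := Hre n Hn); lra. }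
set (k := S (Nat.max m n1)).
assert (Hk := Hphin k).
destruct (phi k) as [|p] eqn:Ep; [lia|].
destruct (exp_iter_small_near a B z1 p) as [w [Hw Hsmall]].
{ intros j; split; [apply Ha0|apply ha]. }
{ apply Him; lia. }
{ apply Rle_trans with (1 := HB), Hre; lia. }
destruct (Hcover p ltac:(lia) w Hw) as [z2 [Hz2 Hpz2]].
assert (Hlow := sphere_height_lower _ (Hsmall z2 Hpz2)).
assert (H := Hclose z2 k Hz2 ltac:(lia)).
cbv beta in H; rewrite Ep in H.
apply Rabs_lt_between in H; lra.
Qed.
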